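(* For every nonnegative integer $d$ there exists a constant $C_d>0$, depending only on $d$, such that the following holds. Let $n\ge d$ ($n\geq 1$), $k\ge 1$ and $r\ge 0$ be integers with $(r+1)/n\le 1/2$, and let $F\in\mathcal{S}^k[x]$ be a symmetric polynomial matrix of degree $d$ in $x=(x_1,\dots,x_n)$, not identically zero on $\{0,1\}^n$. Then $$\frac{F^{(r)}-F_{\min}}{\|F\|_\infty}\le C_d\cdot\xi^n_{r+1}/n .$$
   Context: Write $\mathbb{B}^n=\{0,1\}^n$ and let $\mu$ be the uniform probability measure on $\mathbb{B}^n$. $\mathcal{S}^k$ is the space of real symmetric $k\times k$ matrices and $\mathcal{S}^k[x]$ the space of polynomials in $x=(x_1,\dots,x_n)$ with coefficients in $\mathcal{S}^k$. For $A\in\mathcal{S}^k$, $\|A\|$ is the spectral norm and $\lambda_{\min}(A)$ the smallest eigenvalue. For $F\in\mathcal{S}^k[x]$ put $$F_{\min}:=\min_{x\in\mathbb{B}^n}\lambda_{\min}(F(x)),\qquad \|F\|_\infty:=\max_{x\in\mathbb{B}^n}\|F(x)\|.$$ $\Sigma^{k\times k}_r$ is the set of polynomial matrices $S\in\mathcal{S}^k[x]$ of the form $S(x)=\sum_i U_i(x)U_i(x)^\top$ (finite sum), where $U_i\in\mathbb{R}^{k\times m}[x]$ for some $m\in\mathbb{N}$ and $\deg U_i\le r$. The inner Lasserre bound is $$F^{(r)}:=\inf_{S\in\Sigma^{k\times k}_r}\Big\{\int_{\mathbb{B}^n}\mathrm{Tr}\big(F(x)S(x)\big)d\mu(x):\int_{\mathbb{B}^n}\mathrm{Tr}\big(S(x)\big)d\mu(x)=1\Big\}.$$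 The Krawtchouk polynomial of degree $j$ with parameter $n$ is $\mathcal{K}^n_j(t)=\sum_{i=0}^j(-1)^i\binom{t}{i}\binom{n-t}{j-i}$. For $1\le j\le n$, $\xi^n_j$ denotes its least (smallest real) root. *)

(* Defs.v *)
(* [mpoly] is imported without its notations, which clash with those of
   MathComp-Analysis. *)
From HB Require Import structures.
From mathcomp Require Import all_boot all_order all_algebra.
From mathcomp Require Import classical_sets reals.
From mathcomp Require Import -(notations) mpoly.

Set Implicit Arguments.
Unset Strict Implicit.
Unset Printing Implicit Defensive.

Import Order.TTheory GRing.Theory Num.Theory.
Local Open Scope ring_scope.
Local Open Scope classical_set_scope.

Notation cube n := {ffun 'I_n -> bool}.

(* k x m matrices of real polynomials in n variables, representing
   polynomials with k x m matrix coefficients. Symmetry of the coefficients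
   amounts to symmetry of the matrix of polynomials. *)
Notation polymx R n k m := 'M[mpoly n R]_(k, m).

Section PolynomialMatrices.
Variables (R : realType) (n : nat).

Definition cube_point (x : cube n) : 'I_n -> R := fun i => (x i)%:R.

Definition mxeval k m (F : polymx R n k m) (x : cube n) : 'M[R]_(k, m) :=
  map_mx (meval (cube_point x)) F.

(* Maximal degree of an entry; [mmeasure mdeg] is the degree plus one, and the zero
   matrix gets degree 0. *)
Definition mxdeg k m (F : polymx R n k m) : nat :=
  \max_(i < k) \max_(j < m) (mmeasure mdeg (F i j)).-1.

(* Integral over the cube against the uniform probability measure. *)
Definition cube_mean (f : cube n -> R) : R :=
  (\sum_(x : cube n) f x) / (2 ^ n)%:R.

End PolynomialMatrices.

Section Spectral.
Variables (R : realType) (k : nat).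

Definition norm2 (v : 'cV[R]_k) : R := Num.sqrt (\sum_(i < k) v i 0 ^+ 2).

(* Operator norm induced by the Euclidean norm. *)
Definition spectral_norm (A : 'M[R]_k) : R :=
  sup [set norm2 (A *m v) | v in [set v : 'cV[R]_k | norm2 v = 1]].

(* For k > 0 and A symmetric, the infimum is over a nonempty finite set,
   hence a minimum. *)
Definition lambda_min (A : 'M[R]_k) : R := inf [set a : R | eigenvalue A a].

End Spectral.

Section InnerBound.
Variables (R : realType) (n k : nat).
Implicit Types (F S : polymx R n k k) (r : nat).

(* The default value of the iterated minimum is the value at a point of the
   cube, so that it does not affect the minimum. *)
Definition Fmin F : R :=
  \big[Order.min/lambda_min (mxeval F [ffun=> false])]_(x : cube n)
    lambda_min (mxeval F x).

(* The default value 0 is harmless since spectral norms are nonnegative. *)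
Definition Fnorm F : R :=
  \big[Order.max/0]_(x : cube n) spectral_norm (mxeval F x).

Definition sos_mx r S : Prop :=
  exists (m N : nat) (U : 'I_N -> polymx R n k m),
    (forall i, (mxdeg (U i) <= r)%N) /\ S = \sum_(i < N) U i *m (U i)^T.

(* For k > 0 and F symmetric, the set of values is nonempty and bounded below
   by [Fmin F], so that [inf] is the true infimum. *)
Definition inner_bound F r : R :=
  inf [set cube_mean (fun x => \tr (mxeval F x *m mxeval S x)) | S in
         [set S | sos_mx r S /\ cube_mean (fun x => \tr (mxeval S x)) = 1]].

End InnerBound.

Section Krawtchouk.
Variable R : realType.

(* The binomial coefficient p (p - 1) ... (p - i + 1) / i! of a polynomial. *)
Definition binom_poly (p : {poly R}) (i : nat) : {poly R} :=
  (i`!%:R)^-1 *: \prod_(l < i) (p - l%:R%:P).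

Definition krawtchouk (n j : nat) : {poly R} :=
  \sum_(i < j.+1)
    (-1) ^+ i *: (binom_poly 'X i * binom_poly (n%:R%:P - 'X) (j - i)).

(* The least root when 1 <= j <= n: the set of real roots is then finite and
   nonempty. *)
Definition xi (n j : nat) : R := inf [set t : R | root (krawtchouk n j) t].

End Krawtchouk.

(* Main.v *)
(* Let [y] be a point of the cube and [v] a unit vector with F(y) v = F_min v, and
   restrict to the matrices S(x) = w(|x - y|) v v^T, where |x - y| is the Hamming
   distance and [w] a normalized square of a polynomial of degree at most [r].  The
   objective becomes the mean of f(x) w(|x - y|) for the scalar polynomial
   f = v^T F v, with f(y) = F_min and |f| <= ||F||.  The averages of [f] over the
   spheres around [y] are the values g(t) at t = 0, ..., n of a polynomial of degree
   at most [d]; Lagrange interpolation at d + 1 equidistant integers gives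
   g(t) - g(0) <= C_d (t / n) ||F||.  It remains to make the w-mean of [t] small:
   for [w] proportional to (K_{r+1} / (t - xi))^2 it equals [xi], by orthogonality
   of the Krawtchouk polynomials. *)
Require Import Defs.
From HB Require Import structures.
From mathcomp Require Import all_boot all_order all_algebra.
From mathcomp Require Import classical_sets reals.
From mathcomp Require Import -(notations) mpoly.
From mathcomp Require Import boolp complex spectral zify ring lra.

Set Implicit Arguments.
Unset Strict Implicit.
Unset Printing Implicit Defensive.

Import Order.TTheory GRing.Theory Num.Theory.
Local Open Scope ring_scope.

(** * Least roots, falling factorials and degree counts for univariate polynomials *)

Lemma inf_min (R : realType) (E : set R) (m : R) :
  E m -> (forall y, E y -> m <= y) -> inf E = m.
Proof.
move=> Em lem; apply/eqP; rewrite eq_le; apply/andP; split.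
  by apply: ge_inf Em; exists m.
by apply: lb_le_inf; first by exists m.
Qed.

(** Induction on the size: divide by the factor of the known root [x]; the least root is then [x]
    itself or the smaller of [x] and the least root of the quotient. *)
Lemma least_root (R : realType) (p : {poly R}) (x : R) :
  p != 0 -> root p x ->
  exists2 m, root p m & forall y, root p y -> m <= y.
Proof.
have [n] := ubnP (size p); elim: n p x => // n IHn p x szp p0 px.
have [q defp] := factor_theorem _ _ px.
have q0 : q != 0 by apply: contraNneq p0 => q0; rewrite defp q0 mul0r.
have [[y qy]|nq] := pselect (exists y, root q y).
  have [|m qm lem] := IHn q y _ q0 qy.
    by move: szp; rewrite defp size_Mmonic ?monicXsubC // size_XsubC addn2.
  exists (Order.min m x) => [|z]; last first.
    rewrite defp rootM root_XsubC => /orP[/lem mz|/eqP->].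
      by rewrite ge_min mz.
    by rewrite ge_min lexx orbT.
  by case: leP => // _; rewrite defp rootM qm.
exists x => // y; rewrite defp rootM root_XsubC => /orP[qy|/eqP->//].
by case: nq; exists y.
Qed.

(** Serves both [xi] and [lambda_min], the latter through the characteristic polynomial. *)
Lemma root_inf (R : realType) (p : {poly R}) :
  p != 0 -> (exists x, root p x) -> root p (inf [set t : R | root p t]%classic).
Proof.
by move=> p0 [x px]; have [m pm lem] := least_root p0 px; rewrite (@inf_min _ _ m).
Qed.

Lemma natr_ffact (R : pzRingType) (m i : nat) :
  \prod_(l < i) (m%:R - l%:R) = (m ^_ i)%:R :> R.
Proof.
elim: i => [|i IHi]; first by rewrite big_ord0.
rewrite big_ord_recr /= IHi ffactnSr natrM.
have [le_im|lt_mi] := leqP i m; first by rewrite natrB.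
by rewrite ffact_small // !mul0r.
Qed.

Lemma size_prod_linear (R : comNzRingType) (n : nat) (F : 'I_n -> {poly R}) :
  (forall i, size (F i) <= 2)%N -> (size (\prod_(i < n) F i)%R <= n.+1)%N.
Proof.
elim: n F => [|n IHn] F szF; first by rewrite big_ord0 size_poly1.
rewrite big_ord_recr /=; apply: leq_trans (size_polyMleq _ _) _.
by rewrite -subn1 leq_subLR add1n -addn2 leq_add ?szF ?IHn.
Qed.

Lemma size_polyC_subX (R : nzRingType) (c : R) : (size (c%:P - 'X)%R <= 2)%N.
Proof. by rewrite -opprB size_polyN size_XsubC. Qed.

Lemma poly0_nat (R : numDomainType) (p : {poly R}) (N : nat) :
  (size p <= N)%N -> (forall t : 'I_N, p.[t%:R] = 0) -> p = 0.
Proof.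
move=> szp p_0; apply: contraTeq szp => p0; rewrite -ltnNge.
have := @max_poly_roots _ p [seq t%:R | t : 'I_N] p0.
rewrite size_map size_enum_ord; apply; last first.
  by rewrite map_inj_uniq ?enum_uniq // => s t /eqP; rewrite eqr_nat => /eqP/val_inj.
by apply/allP => x /mapP[t _ ->]; rewrite /root p_0.
Qed.

(** * Krawtchouk polynomials *)

Section Krawtchouk.
Variable R : realType.
Implicit Types (n j t m : nat) (p : {poly R}).

Lemma size_binom_poly p i : (size p <= 2)%N -> (size (binom_poly p i) <= i.+1)%N.
Proof.
move=> szp; apply: leq_trans (size_scale_leq _ _) _.
apply: size_prod_linear => l; rewrite (leq_trans (size_polyD _ _)) //.
by rewrite geq_max szp size_polyN (leq_trans (size_polyC_leq1 _)).
Qed.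

Lemma horner_binom_poly p (x : R) m i : p.[x] = m%:R ->
  (binom_poly p i).[x] = 'C(m, i)%:R.
Proof.
move=> px; rewrite hornerZ horner_prod.
under eq_bigr do rewrite !hornerE px.
rewrite natr_ffact -bin_ffact natrM mulrC mulfK //.
by rewrite pnatr_eq0 -lt0n fact_gt0.
Qed.

Lemma size_krawtchouk n j : (size (krawtchouk R n j) <= j.+1)%N.
Proof.
apply: leq_trans (size_sum _ _ _) _; apply/bigmax_leqP => i _.
apply: leq_trans (size_scale_leq _ _) _; apply: leq_trans (size_polyMleq _ _) _.
rewrite -subn1 leq_subLR add1n.
have -> : (j.+2 = i.+1 + (j - i).+1)%N by have := ltn_ord i; lia.
by rewrite leq_add // size_binom_poly ?size_polyC_subX // size_polyX.
Qed.

Lemma coef_one_addX_exp (c : R) t i :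
  ((1 + c *: 'X) ^+ t)`_i = c ^+ i * 'C(t, i)%:R.
Proof.
rewrite exprDn coef_sum.
under eq_bigr do rewrite expr1n mul1r exprZn coefMn coefZ coefXn.
have [lt_it|le_ti] := ltnP i t.+1; last first.
  rewrite bin_small // mulr0 big1 // => l _.
  by rewrite gtn_eqF ?mulr0 ?mul0rn // (leq_trans (ltn_ord l)).
rewrite (bigD1 (Ordinal lt_it)) //= eqxx mulr1 big1 ?addr0 ?mulr_natr // => l.
by rewrite -val_eqE eq_sym => /= /negPf->; rewrite mulr0 mul0rn.
Qed.

(** Generating function: the defining sum is the Cauchy product of the binomial expansions of the
    two powers. In this form sums over [t] can be taken before the coefficient is extracted. *)
Lemma horner_krawtchouk n j t : (t <= n)%N ->
  (krawtchouk R n j).[t%:R] = ((1 - 'X) ^+ t * (1 + 'X) ^+ (n - t))`_j.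
Proof.
move=> le_tn; rewrite horner_sum coefM; apply: eq_bigr => i _.
rewrite hornerZ hornerM (horner_binom_poly _ (hornerX _)).
rewrite (@horner_binom_poly _ _ (n - t)) ?hornerE ?natrB //.
have -> : 1 + 'X = 1 + 1 *: 'X :> {poly R} by rewrite scale1r.
have -> : 1 - 'X = 1 + (-1) *: 'X :> {poly R} by rewrite scaleN1r.
by rewrite !coef_one_addX_exp expr1n mul1r.
Qed.

Lemma krawtchouk_at0 n j : (krawtchouk R n j).[0] = 'C(n, j)%:R.
Proof.
rewrite -[0]/(0%:R) horner_krawtchouk // expr0 mul1r subn0.
by rewrite -[X in 1 + X]scale1r coef_one_addX_exp expr1n mul1r.
Qed.

Lemma krawtchouk_neq0 n j : (j <= n)%N -> krawtchouk R n j != 0.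
Proof.
move=> le_jn; apply/eqP => K0; have := krawtchouk_at0 n j.
by rewrite K0 horner0 => /eqP; rewrite eq_sym pnatr_eq0 -leqn0 leqNgt bin_gt0 le_jn.
Qed.

(** Trinomial revision C(n,t) C(t,m) = C(n,m) C(n-m,t-m), followed by the binomial theorem in s = t
    - m. *)
Lemma sum_bin_bin (A : comPzRingType) (a b : A) n m : (m <= n)%N ->
  \sum_(t < n.+1) ('C(n, t) * 'C(t, m))%:R * (a ^+ t * b ^+ (n - t)) =
  'C(n, m)%:R * a ^+ m * (a + b) ^+ (n - m).
Proof.
move=> le_mn; rewrite -(big_mkord xpredT
  (fun t => ('C(n, t) * 'C(t, m))%:R * (a ^+ t * b ^+ (n - t)))).
rewrite (big_cat_nat (n := m)) //= ?leqW // big_nat_cond big1 ?add0r; last first.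
  by move=> t; rewrite andbT => /andP[_ lt_tm]; rewrite (bin_small lt_tm) muln0 mul0r.
rewrite -{1}[m]add0n big_addn big_mkord subSn // addrC exprDn big_distrr /=.
apply: eq_bigr => s _; have le_sm : (s + m <= n)%N by have := ltn_ord s; lia.
have -> : ('C(n, s + m) * 'C(s + m, m) = 'C(n, m) * 'C(n - m, s))%N.
  apply/eqP; rewrite -(eqn_pmul2r (fact_gt0 m)) -(eqn_pmul2r (fact_gt0 s)).
  rewrite -(eqn_pmul2r (fact_gt0 (n - (s + m)))); apply/eqP.
  have e1 := bin_fact le_sm; have e2 := bin_fact (leq_addl s m).
  have e3 := bin_fact (leq_trans (leq_addl s m) le_sm).
  have le_sm' : (s <= n - m)%N by lia.
  have e4 := bin_fact le_sm'; rewrite addnK in e2.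
  rewrite -subnDA addnC in e4.
  nia.
rewrite exprD -subnDA [(m + s)%N]addnC -mulr_natr natrM; ring.
Qed.

(** It suffices to test falling factorials, that is m! C(t,m) with m < j. Summing the generating
    function against C(n,t) C(t,m) gives C(n,m) (1 - X)^m 2^(n-m), of degree at most m, so its
    coefficient of index [j] vanishes. *)
Lemma krawtchouk_orthogonal n j p : (j <= n)%N -> (size p <= j)%N ->
  \sum_(t < n.+1) 'C(n, t)%:R * ((krawtchouk R n j).[t%:R] * p.[t%:R]) = 0.
Proof.
(* The size bound is separated from [j], so that the induction lowers [m] while [j] stays fixed. *)
suff H m (q : {poly R}) : (m <= j <= n)%N -> (size q <= m)%N ->
    \sum_(t < n.+1) 'C(n, t)%:R * ((krawtchouk R n j).[t%:R] * q.[t%:R]) = 0.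
  by move=> le_jn; apply: H; rewrite leqnn.
elim: m q => [|m IHm] {}p /andP[lt_mj le_jn] szp.
  rewrite leqn0 size_poly_eq0 in szp; rewrite (eqP szp).
  by rewrite big1 // => t _; rewrite horner0 !mulr0.
pose B := \prod_(l < m) ('X - (l%:R : R)%:P).
have Bmon : B \is monic by apply: monic_prod => l _; rewrite monicXsubC.
have szB : size B = m.+1.
  by rewrite /B -big_enum size_prod_XsubC size_enum_ord.
(* Subtracting the multiple of the monic falling factorial [B] removes the coefficient of index
   [m]. *)
pose q := p - p`_m *: B.
have -> : p = p`_m *: B + q by rewrite addrC subrK.
have szq : (size q <= m)%N.
  apply/leq_sizeP => i le_mi; rewrite coefB coefZ.
  move: le_mi; rewrite leq_eqVlt => /orP[/eqP<-|lt_mi].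
    have /monicP := Bmon; rewrite lead_coefE szB /= => ->.
    by rewrite mulr1 subrr.
  have -> : p`_i = 0 by apply: nth_default; apply: leq_trans szp _.
  have -> : B`_i = 0 by apply: nth_default; rewrite szB.
  by rewrite mulr0 subrr.
under eq_bigr do rewrite hornerD hornerZ !mulrDr.
rewrite big_split /= IHm ?addr0 //; last by rewrite ltnW.
pose P : {poly R} := \sum_(t < n.+1) ('C(n, t) * 'C(t, m))%:R *
  ((1 - 'X) ^+ t * (1 + 'X) ^+ (n - t)).
have szP : (size P <= m.+1)%N.
  rewrite /P sum_bin_bin; last by lia.
  have -> : 1 - 'X + (1 + 'X) = 2%:R%:P :> {poly R}.
    by rewrite addrACA addNr addr0 -polyCD.
  rewrite -polyC_exp -polyC_natr mulrAC -polyCM mul_polyC.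
  apply: leq_trans (size_scale_leq _ _) _.
  apply: leq_trans (size_poly_exp_leq _ _) _.
  by rewrite ltnS -[leqRHS]mul1n leq_mul // -subn1 leq_subLR (size_polyC_subX 1).
have P0 := nth_default 0 (leq_trans szP lt_mj).
transitivity (p`_m * m`!%:R * P`_j); last by rewrite P0 mulr0.
rewrite coef_sum mulr_sumr; apply: eq_bigr => t _.
have le_tn : (t <= n)%N by rewrite -ltnS.
rewrite (horner_krawtchouk _ le_tn).
rewrite -polyC_natr mul_polyC coefZ.
rewrite horner_prod.
under eq_bigr do rewrite hornerXsubC.
by rewrite natr_ffact -bin_ffact !natrM; ring.
Qed.

(** For j > 0 the polynomial is orthogonal to the constant 1. Being positive at 0, it must be
    negative at some integer of [0, n], and the intermediate value theorem applies. *)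
Lemma krawtchouk_root n j : (0 < j <= n)%N -> exists x, root (krawtchouk R n j) x.
Proof.
move=> /andP[j0 le_jn]; set K := krawtchouk R n j.
have K0 : 0 < K.[0] by rewrite krawtchouk_at0 ltr0n bin_gt0.
have [t Kt] : exists t : 'I_n.+1, K.[t%:R] < 0.
  apply: contrapT => noneg.
  have Kge0 (t : 'I_n.+1) : 0 <= K.[t%:R].
    by rewrite leNgt; apply/negP => Kt; apply: noneg; exists t.
  have := @krawtchouk_orthogonal n j 1 le_jn; rewrite size_poly1 => /(_ j0).
  apply/eqP; rewrite gt_eqF // big_ord_recl /= hornerC bin0 mul1r mulr1.
  rewrite ltr_pwDl // sumr_ge0 // => t _.
  by rewrite hornerC mulr1 mulr_ge0 // (Kge0 (lift ord0 t)).
have [||x _ rx] := @poly_ivt R (- K) 0 t%:R.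
- by [].
- by rewrite !hornerN !oppr_le0 oppr_ge0 !ltW.
by exists x; rewrite -rootN.
Qed.

Lemma root_xi n j : (0 < j <= n)%N -> root (krawtchouk R n j) (xi R n j).
Proof.
move=> hj; apply: root_inf; last exact: krawtchouk_root.
by case/andP: hj => _; exact: krawtchouk_neq0.
Qed.

(* The weight is the square of [krawtchouk R n r.+1 / ('X - xi)]: orthogonality
   kills the mean of [t - xi]. *)
Lemma xi_weight n r : (r < n)%N ->
  exists u : {poly R}, [/\ (size u <= r.+1)%N,
    0 < \sum_(t < n.+1) 'C(n, t)%:R * u.[t%:R] ^+ 2 &
    \sum_(t < n.+1) 'C(n, t)%:R * (t%:R * u.[t%:R] ^+ 2) =
    xi R n r.+1 * \sum_(t < n.+1) 'C(n, t)%:R * u.[t%:R] ^+ 2].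
Proof.
move=> lt_rn; have K0 := krawtchouk_neq0 lt_rn.
have /factor_theorem[u defK] := @root_xi n r.+1 lt_rn.
have u0 : u != 0 by apply: contraNneq K0 => u0; rewrite defK u0 mul0r.
have szu : (size u <= r.+1)%N.
  have := size_krawtchouk n r.+1; rewrite defK size_Mmonic ?monicXsubC //.
  by rewrite size_XsubC addn2.
exists u; split => //.
  have ge0 (t : 'I_n.+1) : true -> 0 <= 'C(n, t)%:R * u.[t%:R] ^+ 2 :> R.
    by move=> _; rewrite mulr_ge0 // sqr_ge0.
  rewrite lt0r sumr_ge0 // andbT; apply/eqP => /eqP.
  (* If the sum were 0, [u] would vanish at 0, ..., r, which are points of positive weight; this is
     too many roots for its size. *)
  rewrite psumr_eq0 // => /allP u_0; case/eqP: u0; apply: (@poly0_nat _ _ r.+1) => // t.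
  have lt_tn : (t < n.+1)%N by rewrite (leq_trans (ltn_ord t)) ?leqW.
  have := u_0 (Ordinal lt_tn) (mem_index_enum _); rewrite /= mulf_eq0 sqrf_eq0.
  by rewrite pnatr_eq0 -leqn0 leqNgt bin_gt0 -ltnS lt_tn => /eqP.
apply/eqP; rewrite -subr_eq0 mulr_sumr -sumrB; apply/eqP.
rewrite -[RHS](@krawtchouk_orthogonal n r.+1 u lt_rn szu).
by apply: eq_bigr => t _; rewrite defK hornerM hornerXsubC; ring.
Qed.

End Krawtchouk.

(** * Increments of polynomials bounded on 0, ..., n *)

Section Interpolation.
Variables (R : realType) (D : nat).

Lemma poly_bounded (p : {poly R}) (b : R) :
  exists2 B, 0 <= B & forall s, 0 <= s <= b -> `|p.[s]| <= B.
Proof.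
have [b0|b0] := leP 0 b; last first.
  by exists 0 => // s /andP[s0 /(le_trans s0)]; rewrite leNgt b0.
exists (\sum_(i < size p) `|p`_i| * b ^+ i) => [|s /andP[s0 sb]].
  by rewrite sumr_ge0 // => i _; rewrite mulr_ge0 ?exprn_ge0.
rewrite horner_coef (le_trans (ler_norm_sum _ _ _)) // ler_sum // => i _.
by rewrite normrM normrX (ger0_norm s0) ler_wpM2l // lerXn2r.
Qed.

Definition lagrange_nat (i : 'I_D.+1) : {poly R} :=
  \prod_(j < D.+1 | j != i) ((i%:R - j%:R)^-1 *: ('X - j%:R%:P)).

Lemma horner_lagrange_nat i (j : 'I_D.+1) : (lagrange_nat i).[j%:R] = (i == j)%:R.
Proof.
rewrite horner_prod; have [<-|neq_ij] := eqVneq i j.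
  rewrite big1 // => l neq_li; rewrite hornerZ hornerXsubC mulVf //.
  by rewrite subr_eq0 eqr_nat eq_sym.
by rewrite (bigD1 j) 1?eq_sym //= hornerZ hornerXsubC subrr mulr0 mul0r.
Qed.

Lemma size_lagrange_nat i : (size (lagrange_nat i) <= D.+1)%N.
Proof.
rewrite /lagrange_nat scaler_prod; apply: leq_trans (size_scale_leq _ _) _.
by rewrite -big_filter size_prod_XsubC size_filter -sum1_count sum1_card cardC1
  card_ord.
Qed.

Lemma lagrange_natE (P : {poly R}) : (size P <= D.+1)%N ->
  P = \sum_(i < D.+1) P.[i%:R] *: lagrange_nat i.
Proof.
move=> szP; apply/eqP; rewrite -subr_eq0; apply/eqP/(@poly0_nat _ _ D.+1) => [|j].
  rewrite (leq_trans (size_polyD _ _)) // geq_max szP size_polyN.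
  apply: leq_trans (size_sum _ _ _) _; apply/bigmax_leqP => i _.
  exact: leq_trans (size_scale_leq _ _) (size_lagrange_nat i).
rewrite hornerD hornerN horner_sum (bigD1 j) //= hornerZ horner_lagrange_nat eqxx.
rewrite mulr1 big1 ?addr0 ?subrr // => i /negPf neq_ij.
by rewrite hornerZ horner_lagrange_nat neq_ij mulr0.
Qed.

(** The difference p - p(0) is divisible by X, and the quotient is bounded on [0, b]. *)
Lemma poly_lipschitz0 (p : {poly R}) (b : R) :
  exists2 B, 0 <= B & forall s, 0 <= s <= b -> `|p.[s] - p.[0]| <= B * s.
Proof.
have /factor_theorem[q defq] : root (p - p.[0]%:P) 0.
  by rewrite /root !hornerE subrr.
have [B B0 qB] := poly_bounded q b; exists B => // s /[dup] s01 /andP[s0 _].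
have -> : p.[s] - p.[0] = q.[s] * s.
  by have := congr1 (horner^~ s) defq; rewrite /= !hornerE subr0.
by rewrite normrM (ger0_norm s0) ler_wpM2r // qB.
Qed.

(* Interpolate [g] at the multiples of [q = n %/ D]: after rescaling by [q] the nodes
   are 0, ..., D and all of [0, n] is mapped into [0, 2 * D]. *)
Lemma poly_increment_bound : (0 < D)%N ->
  exists2 C : R, 0 < C &
    forall (n : nat) (g : {poly R}) (M : R), (D <= n)%N -> (size g <= D.+1)%N ->
      (forall t : nat, (t <= n)%N -> `|g.[t%:R]| <= M) ->
      forall t : nat, (t <= n)%N -> g.[t%:R] - g.[0] <= C * (t%:R / n%:R) * M.
Proof.
move=> D0; pose b : R := (2 * D)%:R.
have /fin_all_exists2[B B0 lB] (i : 'I_D.+1) := poly_lipschitz0 (lagrange_nat i) b.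
(* The factor [b] comes from s <= b t / n below; the summand 1 only makes the constant positive. *)
exists (b * \sum_i B i + 1) => [|n g M le_Dn szg gM t le_tn].
  by rewrite ltr_wpDl // mulr_ge0 ?ler0n // sumr_ge0.
have n0 : (0 < n)%N by exact: leq_trans le_Dn.
have M0 : 0 <= M by apply: le_trans (gM 0 isT).
pose q := (n %/ D)%N; have q0 : (0 < q)%N by rewrite divn_gt0.
(* Since q >= 1, n < (q + 1) D <= 2 q D. *)
have le_n : (n <= 2 * D * q)%N.
  by have := ltn_ceil n D0; rewrite -/q; nia.
pose P := g \Po (q%:R *: 'X).
have PE s : P.[s] = g.[q%:R * s] by rewrite horner_comp !hornerE.
have szP : (size P <= D.+1)%N.
  apply: leq_trans (size_comp_poly_leq _ _) _; rewrite ltnS.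
  rewrite size_scale ?pnatr_eq0 -?lt0n // size_polyX muln1.
  by rewrite -subn1 leq_subLR add1n.
pose s : R := t%:R / q%:R.
have qR : q%:R != 0 :> R by rewrite pnatr_eq0 -lt0n.
have qR0 : 0 < q%:R :> R by rewrite ltr0n.
have nR0 : 0 < n%:R :> R by rewrite ltr0n.
have le_s : s <= b * (t%:R / n%:R).
  rewrite ler_pdivrMr // mulrAC mulrA ler_pdivlMr // mulrC.
  by rewrite -!natrM ler_nat leq_mul2r le_n orbT.
have s0 : 0 <= s by rewrite divr_ge0 ?ler0n.
have sb : s <= b.
  by apply: le_trans le_s _; rewrite ler_piMr ?ler0n // ler_pdivrMr // mul1r ler_nat.
have -> : g.[t%:R] - g.[0] = P.[s] - P.[0].
  by rewrite !PE mulr0 mulrC divfK.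
rewrite (lagrange_natE szP) !horner_sum -sumrB.
(* The node [i] is at most [D], so q i <= n and the value of [P] there is a value of [g] bounded by
   [M]; each basis polynomial grows by at most [B i * s]. *)
apply: (@le_trans _ _ (\sum_i M * (B i * s))).
  apply: ler_sum => i _; rewrite !hornerZ -mulrBr (le_trans (ler_norm _)) //.
  rewrite normrM ler_pM // ?lB ?s0 // PE -natrM gM //.
  by have := ltn_ord i; have := leq_divM n D; rewrite -/q; nia.
rewrite -mulr_sumr -mulr_suml mulrC ler_wpM2r // mulrDl mul1r.
rewrite (le_trans (ler_wpM2l _ le_s)) ?sumr_ge0 // mulrCA mulrA ler_wpDr //.
by rewrite divr_ge0 ?ler0n.
Qed.

End Interpolation.

(** * Averages over Hamming spheres *)

Section SphereAverages.
Variables (R : realType) (n : nat) (y : cube n).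
Implicit Types (x : cube n) (A : {set 'I_n}) (f : cube n -> R) (d : nat).

Definition hamming (x y : cube n) : nat := (\sum_(i < n) (x i != y i))%N.

Lemma hamming_le x : (hamming x y <= n)%N.
Proof.
rewrite -[leqRHS]card_ord -sum1_card; apply: leq_sum => i _; exact: leq_b1.
Qed.

Lemma hammingxx : hamming y y = 0%N.
Proof. by rewrite /hamming big1 // => i _; rewrite eqxx. Qed.

Lemma hamming0 x : hamming x y = 0%N -> x = y.
Proof.
move=> /eqP; rewrite sum_nat_eq0 => /forallP H; apply/ffunP => i.
by have := H i; rewrite eqb0 negbK => /eqP.
Qed.

Lemma sum_by_hamming (f : cube n -> R) :
  \sum_(x : cube n) f x = \sum_(t < n.+1) \sum_(x | hamming x y == t) f x.
Proof.
rewrite (partition_big (fun x => inord (hamming x y) : 'I_n.+1) xpredT) //=.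
apply: eq_bigr => t _; apply: eq_bigl => x.
by rewrite -val_eqE /= inordK // ltnS hamming_le.
Qed.

(** Both sides count the t-subsets of an m-set together with [a] ordered distinct elements inside
    and [b] outside: choose the subset first, or the elements first. The test t < a guards against
    truncated subtraction, which would turn the right-hand binomial into C(m-(a+b), 0). *)
Lemma bin_ffact_ffact m t a b : (t <= m)%N -> (a + b <= m)%N ->
  ('C(m, t) * (t ^_ a * (m - t) ^_ b) =
   m ^_ (a + b) * (if t < a then 0 else 'C(m - (a + b), t - a)))%N.
Proof.
move=> le_tm le_abm; case: ltnP => [lt_ta|le_at].
  by rewrite ffact_small // mul0n !muln0.
have [lt_b|le_b] := ltnP (m - t) b.
  by rewrite [(m - t) ^_ b]ffact_small // !muln0 bin_small ?muln0 //; lia.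
apply/eqP; rewrite -(eqn_pmul2r (fact_gt0 (t - a))).
rewrite -(eqn_pmul2r (fact_gt0 (m - t - b))); apply/eqP.
have e1 := bin_fact le_tm; have e2 := ffact_fact le_at.
have e3 := ffact_fact le_b; have e4 := ffact_fact le_abm.
have le_ta : (t - a <= m - (a + b))%N by lia.
have := bin_fact le_ta; rewrite (_ : m - (a + b) - (t - a) = m - t - b)%N; last by lia.
move=> e5; transitivity m`!.
  by rewrite -e1 -e2 -e3; ring.
by rewrite -e4 -e5; ring.
Qed.

(** The sphere of radius [t] has C(n,t) points, so g(t) is the mean of [f] over it; sums avoid a
    division. *)
Definition polynomial_averages d f : Prop :=
  exists2 g : {poly R}, (size g <= d.+1)%N &
    forall t, (t <= n)%N -> \sum_(x | hamming x y == t) f x = 'C(n, t)%:R * g.[t%:R].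

Lemma polynomial_averages_lin d (I : Type) (s : seq I) (c : I -> R)
    (f : I -> cube n -> R) :
  (forall i, polynomial_averages d (f i)) ->
  polynomial_averages d (fun x => \sum_(i <- s) c i * f i x).
Proof.
move=> fP; elim: s => [|i s [h szh hP]].
  exists 0 => [|t _]; first by rewrite size_poly0.
  by rewrite horner0 mulr0 big1 // => x _; rewrite big_nil.
have [g szg gP] := fP i; exists (c i *: g + h) => [|t le_tn].
  rewrite (leq_trans (size_polyD _ _)) // geq_max szh andbT.
  exact: leq_trans (size_scale_leq _ _) szg.
under eq_bigr do rewrite big_cons.
by rewrite big_split /= -mulr_sumr gP // hP // hornerD hornerZ; ring.
Qed.

(** The sum factors over the coordinates. For [i] in [A] only x_i = 1 survives and contributes X
    when y_i = 0 and 1 otherwise; every other coordinate contributes 1 + X. *)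
Lemma sum_monomial_hamming A :
  \sum_(x : cube n) (\prod_(i in A) (x i)%:R : R) *: 'X^(hamming x y) =
  'X^(\sum_(i in A) ~~ y i) * (1 + 'X) ^+ (n - #|A|).
Proof.
pose F (i : 'I_n) (b : bool) : {poly R} :=
  (if i \in A then b%:R else 1) *: 'X^(b != y i).
transitivity (\sum_(x : cube n) \prod_(i < n) F i (x i)).
  apply: eq_bigr => x _; rewrite scaler_prod prodrXr; congr (_ *: _).
  by rewrite [LHS]big_mkcond.
rewrite -bigA_distr_bigA (bigID (mem A)) /=; congr (_ * _).
  rewrite -prodrXr; apply: eq_bigr => i iA.
  by rewrite big_bool /F iA /= mulr0n mulr1n scale0r addr0 scale1r; case: (y i).
have -> : (n - #|A|)%N = #|~: A| by rewrite [RHS]cardsCs finset.setCK card_ord.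
rewrite -prodr_const.
apply: eq_big => i; first by rewrite inE.
move=> /negPf niA; rewrite big_bool /F niA !scale1r.
by case: (y i) => //=; rewrite addrC.
Qed.

Lemma polynomial_averages_monomial d A : (#|A| <= d)%N ->
  polynomial_averages d (fun x => \prod_(i in A) (x i)%:R).
Proof.
move=> le_Ad; pose a := (\sum_(i in A) ~~ y i)%N.
have le_aA : (a <= #|A|)%N by rewrite -sum1_card leq_sum // => i _; exact: leq_b1.
have le_An : (#|A| <= n)%N by rewrite -[leqRHS]card_ord max_card.
pose b := (#|A| - a)%N; have abA : (a + b = #|A|)%N by rewrite subnKC.
(* The sphere sum is the coefficient C(n - |A|, t - a) of the generating function. By
   [bin_ffact_ffact] it equals C(n,t) times falling factorials of t and n - t, of total degree a + b
   = |A|, over that of n. *)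
exists ((n ^_ #|A|)%:R^-1 *: (\prod_(l < a) ('X - l%:R%:P) *
   \prod_(l < b) (n%:R%:P - 'X - l%:R%:P))) => [|t le_tn].
  apply: leq_trans (size_scale_leq _ _) _; apply: leq_trans (size_polyMleq _ _) _.
  rewrite -subn1 leq_subLR add1n (@leq_trans (a.+1 + b.+1)) //; last by lia.
  rewrite leq_add ?size_prod_linear // => i; first by rewrite size_XsubC.
  by rewrite addrAC -polyCB size_polyC_subX.
have -> : \sum_(x : cube n | hamming x y == t) \prod_(i in A) (x i)%:R =
    (\sum_(x : cube n) (\prod_(i in A) (x i)%:R : R) *: 'X^(hamming x y))`_t.
  rewrite coef_sum big_mkcond; apply: eq_bigr => x _.
  by rewrite coefZ coefXn eq_sym; case: eqP; rewrite ?mulr1 ?mulr0.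
rewrite sum_monomial_hamming coefXnM -/a -[X in 1 + X]scale1r.
rewrite hornerZ hornerM !horner_prod.
under eq_bigr do rewrite hornerXsubC.
under [X in _ * (_ * (_ * X))]eq_bigr do rewrite !hornerE -natrB //.
rewrite !natr_ffact mulrCA -!natrM bin_ffact_ffact // ?abA //.
rewrite natrM mulKf ?pnatr_eq0 -?lt0n ?ffact_gt0 //.
by case: ifP => // _; rewrite coef_one_addX_exp expr1n mul1r.
Qed.

Lemma polynomial_averages_meval d (p : mpoly n R) : ((mmeasure mdeg p).-1 <= d)%N ->
  polynomial_averages d (fun x => meval (cube_point R x) p).
Proof.
move=> degp.
(* On the cube x_i^e = x_i for e > 0, so each monomial reduces to the product over its support. The
   value 0 in high degree is never reached on [msupp p], but [polynomial_averages_lin] quantifies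
   over all indices. *)
have -> : (fun x => meval (cube_point R x) p) =
    (fun x => \sum_(m <- msupp p) mcoeff m p *
       (if (mdeg m <= d)%N then \prod_(i in [set i | m i != 0%N]) (x i)%:R else 0)).
  apply: funext => x; rewrite mevalE; apply: eq_big_seq => m pm; congr (_ * _).
  rewrite ifT; last by have := msize_mdeg_lt pm; lia.
  rewrite [RHS]big_mkcond; apply: eq_bigr => i _; rewrite inE /cube_point.
  by case: (m i) => [|e]; rewrite ?expr0 //=; case: (x i); rewrite ?expr1n ?expr0n.
apply: polynomial_averages_lin => m; case: leqP => [le_md|_]; last first.
  exists 0 => [|t _]; first by rewrite size_poly0.
  by rewrite horner0 mulr0 big1.
apply: polynomial_averages_monomial; apply: leq_trans le_md.
rewrite mdegE -sum1_card big_mkcond; apply: leq_sum => i _; rewrite inE.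
by case: (m i).
Qed.

End SphereAverages.

(** * Weighted means of functions with polynomial sphere averages *)

Lemma sum_sphere1 (R : realType) n (y : cube n) t :
  \sum_(x : cube n | hamming x y == t) 1 = 'C(n, t)%:R :> R.
Proof.
have := congr1 (fun p : {poly R} => p`_t) (sum_monomial_hamming R y finset.set0).
rewrite cards0 subn0 big_set0 expr0 mul1r -[X in 1 + X]scale1r.
rewrite coef_one_addX_exp expr1n mul1r => <-.
rewrite coef_sum big_mkcond; apply: eq_bigr => x _.
by rewrite big_set0 scale1r coefXn eq_sym; case: (t == _).
Qed.

(** By [xi_weight] it is a weighted mean of the nonnegative numbers 0, ..., n. *)
Lemma xi_ge0 (R : realType) n r : (r < n)%N -> 0 <= xi R n r.+1.
Proof.
move=> /(xi_weight R)[u [_ W0 xiE]]; rewrite -(pmulr_lge0 _ W0) -xiE.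
by apply: sumr_ge0 => t _; apply: mulr_ge0 => //; apply: mulr_ge0 => //; exact: sqr_ge0.
Qed.

Lemma weighted_sum_bound (R : realType) (D : nat) : (0 < D)%N ->
  exists2 C : R, 0 < C &
    forall n r (y : cube n) (f : cube n -> R) (M : R), (D <= n)%N -> (r < n)%N ->
      polynomial_averages y D f -> (forall x, `|f x| <= M) ->
      exists u : {poly R}, [/\ (size u <= r.+1)%N,
        0 < \sum_x u.[(hamming x y)%:R] ^+ 2 &
        \sum_x f x * u.[(hamming x y)%:R] ^+ 2 <=
        (f y + C * (xi R n r.+1 / n%:R) * M) * \sum_x u.[(hamming x y)%:R] ^+ 2].
Proof.
move=> /(poly_increment_bound R)[C C0 CP]; exists C => // n r y f M le_Dn lt_rn.
move=> [g szg gP] fM; have [u [szu W0 xiE]] := xi_weight R lt_rn; exists u.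
(* The weight is constant on spheres, so only the sphere sums of [k] matter. *)
have sumE (h : {poly R}) (k : cube n -> R) :
    (forall t, (t <= n)%N ->
       \sum_(x | hamming x y == t) k x = 'C(n, t)%:R * h.[t%:R]) ->
    \sum_x k x * u.[(hamming x y)%:R] ^+ 2 =
    \sum_(t < n.+1) 'C(n, t)%:R * (h.[t%:R] * u.[t%:R] ^+ 2).
  move=> kP; rewrite (sum_by_hamming y); apply: eq_bigr => t _.
  have le_tn : (t <= n)%N by rewrite -ltnS.
  by rewrite mulrA -kP // mulr_suml; apply: eq_bigr => x /eqP->.
have WE : \sum_x u.[(hamming x y)%:R] ^+ 2 =
    \sum_(t < n.+1) 'C(n, t)%:R * u.[t%:R] ^+ 2.
  under eq_bigr do rewrite -[_ ^+ 2]mul1r.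
  rewrite (sumE 1) => [|t _]; last by rewrite sum_sphere1 hornerC mulr1.
  by apply: eq_bigr => t _; rewrite hornerC mul1r.
(* g(t) is a mean of values of [f] over a nonempty sphere. *)
have gM t : (t <= n)%N -> `|g.[t%:R]| <= M.
  move=> le_tn; have C_gt0 : 0 < 'C(n, t)%:R :> R by rewrite ltr0n bin_gt0.
  rewrite -(ler_pM2l C_gt0) -{1}(ger0_norm (ltW C_gt0)) -normrM -gP //.
  apply: le_trans (ler_norm_sum _ _ _) _.
  rewrite -(sum_sphere1 R y) mulr_suml; apply: ler_sum => x _.
  by rewrite mul1r.
have g0 : g.[0] = f y.
  have := gP 0 isT; rewrite bin0 mul1r => <-.
  rewrite (bigD1 y) ?hammingxx //= big1 ?addr0 // => x /andP[/eqP/hamming0->].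
  by rewrite eqxx.
split=> //; first by rewrite WE.
rewrite (sumE g) // WE mulrDl -lerBlDl -g0 mulr_sumr -sumrB.
rewrite [leRHS](_ : _ = C / n%:R * M * (xi R n r.+1 *
  \sum_(t < n.+1) 'C(n, t)%:R * u.[t%:R] ^+ 2)); last by ring.
(* With the weighted mean of [t] substituted for [xi], the inequality holds term by term by the
   increment bound [CP]. *)
rewrite -xiE mulr_sumr; apply: ler_sum => t _.
have -> : 'C(n, t)%:R * (g.[t%:R] * u.[t%:R] ^+ 2) -
    g.[0] * ('C(n, t)%:R * u.[t%:R] ^+ 2) =
    (g.[t%:R] - g.[0]) * ('C(n, t)%:R * u.[t%:R] ^+ 2) by ring.
have le_tn : (t <= n)%N by rewrite -ltnS.
have -> : C / n%:R * M * ('C(n, t)%:R * (t%:R * u.[t%:R] ^+ 2)) =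
   C * (t%:R / n%:R) * M * ('C(n, t)%:R * u.[t%:R] ^+ 2) by ring.
by rewrite ler_wpM2r ?CP // mulr_ge0 ?ler0n ?sqr_ge0.
Qed.

(** * Symmetric real matrices *)

Section Spectral.
Variables (R : realType) (k : nat).
Implicit Types (A : 'M[R]_k) (v : 'cV[R]_k).

(** Over the complex numbers an eigenvalue [a] exists. For an eigenvector [v], moving the real
    symmetric matrix across the Hermitian product of [v] with itself shows that [a] equals its
    conjugate. *)
Lemma symmetric_eigenvalue A : (0 < k)%N -> A^T = A -> exists a, eigenvalue A a.
Proof.
move=> k0 symA; pose B := map_mx (real_complex R) A.
have [a] := eigenvalue_closed B k0; move=> /[dup] Ba /eigenvalueP[v vB v0].
pose w := map_mx Num.conj v.
have wB : w *m B = a^* *: w.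
  rewrite -map_mxZ /= -vB map_mxM; congr (_ *m _).
  apply/matrixP => i j; rewrite !mxE /=.
  by rewrite [RHS]conjc_real.
have symB : B^T = B by rewrite map_trmx symA.
have vw0 : (v *m w^T) 0 0 != 0.
  rewrite mxE; apply: contra v0 => /eqP vw.
  apply/eqP/rowP => i; rewrite mxE; apply/eqP; rewrite -normr_eq0 -sqrf_eq0.
  move: vw; under eq_bigr do rewrite !mxE -normCK.
  move/eqP; rewrite psumr_eq0 => [/allP/(_ i (mem_index_enum _)) //|j _].
  exact: exprn_ge0.
have aa : a = a^*.
  apply: (mulIf vw0).
  transitivity ((v *m B *m w^T) 0 0); first by rewrite vB -scalemxAl !mxE.
  by rewrite -mulmxA -{1}symB -trmx_mul wB linearZ /= -scalemxAr !mxE.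
have /complex_realP[b ab] : a \is Num.real by rewrite CrealE -aa.
exists b; move: Ba; rewrite !eigenvalue_root_char ab.
by rewrite -[char_poly B]map_char_poly fmorph_root.
Qed.

Lemma norm2_eq1 v : norm2 v = 1 <-> \sum_i v i 0 ^+ 2 = 1.
Proof.
rewrite /norm2; split=> [v1|->]; last by rewrite sqrtr1.
rewrite -[LHS]sqr_sqrtr ?v1 ?expr1n //.
by rewrite sumr_ge0 // => i _; rewrite sqr_ge0.
Qed.

(** The infimum is attained, being the least root of the characteristic polynomial; symmetry turns
    the row eigenvector into a column, which is then normalized. *)
Lemma lambda_min_eigenvector A : (0 < k)%N -> A^T = A ->
  exists2 v : 'cV[R]_k, norm2 v = 1 & A *m v = lambda_min A *: v.
Proof.
move=> k0 symA; have : eigenvalue A (lambda_min A).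
  have eigE : [set a : R | eigenvalue A a]%classic =
      [set a | root (char_poly A) a]%classic.
    by apply: funext => a; rewrite /= eigenvalue_root_char.
  rewrite /lambda_min eigE eigenvalue_root_char; apply: root_inf.
    by rewrite monic_neq0 // char_poly_monic.
  by have [a] := symmetric_eigenvalue k0 symA; rewrite eigenvalue_root_char; exists a.
move=> /eigenvalueP[w wA w0]; pose c := \sum_i w 0 i ^+ 2.
have c_ge0 i : true -> 0 <= w 0 i ^+ 2 by move=> _; exact: sqr_ge0.
have c0 : 0 < c.
  rewrite lt0r sumr_ge0 // andbT; apply: contra w0; rewrite psumr_eq0 // => /allP w0.
  apply/eqP/rowP => i; rewrite mxE; apply/eqP; rewrite -sqrf_eq0.
  exact: w0 (mem_index_enum _).
exists ((Num.sqrt c)^-1 *: w^T).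
  apply/norm2_eq1; under eq_bigr do rewrite !mxE exprMn.
  by rewrite -mulr_sumr exprVn sqr_sqrtr ?ltW // mulVf // gt_eqF.
rewrite -scalemxAr scalerA mulrC -scalerA; congr (_ *: _).
by rewrite -{1}symA -trmx_mul wA linearZ.
Qed.

Lemma quadratic_le_spectral_norm A v : norm2 v = 1 ->
  `|\sum_i v i 0 * (A *m v) i 0| <= spectral_norm A.
Proof.
move=> v1; apply: (@le_trans _ _ (norm2 (A *m v))); last first.
  apply: ub_le_sup; last by exists v.
  (* The supremum needs a bounded set: entries of a unit vector are at most 1 in absolute value, so
     row sums bound the image. *)
  exists (Num.sqrt (\sum_i (\sum_j `|A i j|) ^+ 2)) => _ [u /norm2_eq1 u1 <-].
  rewrite ler_wsqrtr // ler_sum // => i _.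
  rewrite -[leLHS]real_normK ?num_real // lerXn2r ?nnegrE ?sumr_ge0 //.
  rewrite mxE (le_trans (ler_norm_sum _ _ _)) //.
  rewrite ler_sum // => j _; rewrite normrM ler_piMr //.
  rewrite -(@expr_le1 _ 2) // real_normK ?num_real // -u1 (bigD1 j) //=.
  by rewrite lerDl sumr_ge0 // => l _; rewrite sqr_ge0.
move/norm2_eq1: v1; set w := A *m v => v1; set c := \sum_i _.
rewrite -sqrtr_sqr ler_wsqrtr // -subr_ge0.
(* Cauchy-Schwarz for unit [v]: the defect is the squared length of w - c v. *)
have -> : \sum_i w i 0 ^+ 2 - c ^+ 2 = \sum_i (w i 0 - c * v i 0) ^+ 2.
  transitivity (\sum_i (w i 0 ^+ 2 - 2 * c * (v i 0 * w i 0) + c ^+ 2 * v i 0 ^+ 2)).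
    by rewrite big_split sumrB /= -!mulr_sumr v1 -/c; ring.
  by apply: eq_bigr => i _; ring.
by apply: sumr_ge0 => i _; rewrite sqr_ge0.
Qed.

Lemma mxtrace_gram_ge0 m (U : 'M[R]_(k, m)) : 0 <= \tr (U *m U^T).
Proof.
rewrite /mxtrace sumr_ge0 // => i _; rewrite mxE sumr_ge0 // => c _.
by rewrite mxE -expr2 sqr_ge0.
Qed.

(** A crude bound, from |G_ij| <= tr G for a Gram matrix; it serves to bound from below the set
    whose infimum is [inner_bound]. *)
Lemma mxtrace_gram_ge A m (U : 'M[R]_(k, m)) :
  - (\sum_i \sum_j `|A i j|) * \tr (U *m U^T) <= \tr (A *m (U *m U^T)).
Proof.
set G := U *m U^T.
have GE i j : G i j = \sum_c U i c * U j c.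
  by rewrite mxE; apply: eq_bigr => c _; rewrite mxE.
have trG : \tr G = \sum_c \sum_i U i c ^+ 2.
  rewrite exchange_big; apply: eq_bigr => i _; rewrite GE.
  by apply: eq_bigr => c _; rewrite expr2.
have leG i j : `|G i j| <= \tr G.
  rewrite GE trG (le_trans (ler_norm_sum _ _ _)) // ler_sum // => c _.
  have sq l : U l c ^+ 2 <= \sum_l U l c ^+ 2.
    by rewrite (bigD1 l) //= lerDl sumr_ge0 // => *; rewrite sqr_ge0.
  have := sq i; have := sq j; set s := \sum_l _ => sj si.
  by rewrite ler_norml; apply/andP; split; nra.
rewrite /mxtrace -sumrN mulr_suml; apply: ler_sum => i _.
rewrite mxE -sumrN mulr_suml; apply: ler_sum => j _.
rewrite mulNr lerNl (le_trans (ler_norm _)) // normrN normrM.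
by rewrite ler_wpM2l // leG.
Qed.

End Spectral.

(** * The inner bound *)

Section Kernel.
Variables (R : realType) (n : nat).
Implicit Types (p q : mpoly n R) (u : {poly R}).

Lemma mmeasure_mul_leq p q a b :
  (mmeasure mdeg p <= a.+1)%N -> (mmeasure mdeg q <= b.+1)%N ->
  (mmeasure mdeg (p * q) <= (a + b).+1)%N.
Proof.
have [->|p0] := eqVneq p 0; first by rewrite mul0r mmeasure0.
have [->|q0] := eqVneq q 0; first by rewrite mulr0 mmeasure0.
move=> pa qb; rewrite msizeM // -subn1 leq_subLR add1n -addSn -addnS.
exact: leq_add.
Qed.

Lemma mmeasure_exp_leq p e :
  (mmeasure mdeg p <= 2)%N -> (mmeasure mdeg (p ^+ e) <= e.+1)%N.
Proof.
move=> p2; elim: e => [|e IHe]; first by rewrite expr0 msize1.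
by rewrite exprS; apply: (@mmeasure_mul_leq _ _ 1 e).
Qed.

Definition hamming_mpoly (y : cube n) : mpoly n R :=
  \sum_(i < n) (if y i then 1 - mpolyX R (mnm1 i) else mpolyX R (mnm1 i)).

Lemma meval_hamming_mpoly x y :
  meval (cube_point R x) (hamming_mpoly y) = (hamming x y)%:R.
Proof.
rewrite /hamming_mpoly rmorph_sum natr_sum; apply: eq_bigr => i _ /=.
case: (y i); rewrite ?mevalB ?meval1 mevalXU /cube_point.
  by case: (x i); rewrite ?subrr ?subr0.
by case: (x i).
Qed.

Lemma mmeasure_hamming_mpoly y : (mmeasure mdeg (hamming_mpoly y) <= 2)%N.
Proof.
apply: leq_trans (mmeasure_sum _ _ _ _) _; apply/bigmax_leqP => i _.
have X2 : (mmeasure mdeg (mpolyX R (mnm1 i)) <= 2)%N by rewrite msizeX mdeg1.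
case: (y i) => //; apply: leq_trans (mmeasureD_le _ _ _) _.
by rewrite geq_max mmeasureN X2 msize1.
Qed.

(** The composition of [u] with the Hamming distance to [y]; as [hamming_mpoly] is affine, the
    degree does not exceed that of [u]. *)
Definition kernel_mpoly u y : mpoly n R :=
  \sum_(e < size u) u`_e *: hamming_mpoly y ^+ e.

Lemma meval_kernel_mpoly u x y :
  meval (cube_point R x) (kernel_mpoly u y) = u.[(hamming x y)%:R].
Proof.
rewrite /kernel_mpoly rmorph_sum horner_coef; apply: eq_bigr => e _ /=.
by rewrite mevalZ rmorphXn /= meval_hamming_mpoly.
Qed.

Lemma mmeasure_kernel_mpoly u y r : (size u <= r.+1)%N ->
  (mmeasure mdeg (kernel_mpoly u y) <= r.+1)%N.
Proof.
move=> szu; apply: leq_trans (mmeasure_sum _ _ _ _) _; apply/bigmax_leqP => e _.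
apply: leq_trans (mmeasureZ_le _ _ _) _.
apply: leq_trans (mmeasure_exp_leq _ (mmeasure_hamming_mpoly y)) _.
exact: leq_trans (ltn_ord e) szu.
Qed.

Lemma mxeval_gram k m (U : polymx R n k m) x :
  mxeval (U *m U^T) x = mxeval U x *m (mxeval U x)^T.
Proof. by rewrite /mxeval map_mxM map_trmx. Qed.

Lemma mxeval_sos k m N (U : 'I_N -> polymx R n k m) x :
  mxeval (\sum_(i < N) U i *m (U i)^T) x =
  \sum_(i < N) mxeval (U i) x *m (mxeval (U i) x)^T.
Proof.
rewrite /mxeval raddf_sum; apply: eq_bigr => i _; exact: mxeval_gram.
Qed.

Lemma inner_bound_le k (F S : polymx R n k k) r : sos_mx r S ->
  cube_mean (fun x => \tr (mxeval S x)) = 1 ->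
  inner_bound F r <= cube_mean (fun x => \tr (mxeval F x *m mxeval S x)).
Proof.
move=> sosS trS; apply: ge_inf; last by exists S.
have [B leB] : exists B, forall x, B <= - \sum_i \sum_j `|mxeval F x i j|.
  (* Summing over the whole cube makes the bound independent of [x]. *)
  exists (- \sum_x \sum_i \sum_j `|mxeval F x i j|) => x.
  rewrite lerN2 (bigD1 x) //= lerDl sumr_ge0 // => z _.
  by rewrite !sumr_ge0 // => l _; rewrite sumr_ge0.
exists B => _ [T [[m [N [U [_ ->]]]] trT] <-].
rewrite -[B]mulr1 -trT /cube_mean mulrA ler_wpM2r ?invr_ge0 //.
rewrite mulr_sumr; apply: ler_sum => x _.
rewrite mxeval_sos mulmx_sumr !raddf_sum /= mulr_sumr; apply: ler_sum => i _.
by apply: le_trans (mxtrace_gram_ge _ _); rewrite ler_wpM2r ?mxtrace_gram_ge0.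
Qed.

(** The test matrix is a single square with one column, proportional to u(|x - y|) v; against v v^T
    the trace becomes the quadratic form of [v]. *)
Lemma inner_bound_rank1_le k (F : polymx R n k k) r u y (v : 'cV[R]_k) :
  (size u <= r.+1)%N -> norm2 v = 1 ->
  0 < \sum_x u.[(hamming x y)%:R] ^+ 2 ->
  inner_bound F r * (\sum_x u.[(hamming x y)%:R] ^+ 2) <=
  \sum_x (\sum_i v i 0 * (mxeval F x *m v) i 0) * u.[(hamming x y)%:R] ^+ 2.
Proof.
move=> szu /norm2_eq1 v1; set W := \sum_x _ => W0.
(* c^2 is the mean of u(|x - y|)^2 over the cube, so dividing by [c] makes the mean trace 1. *)
pose c := Num.sqrt (W / (2 ^ n)%:R).
have n2 : 0 < (2 ^ n)%:R :> R by rewrite ltr0n expn_gt0.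
have c2 : c ^+ 2 = W / (2 ^ n)%:R by rewrite sqr_sqrtr // divr_ge0 ?ltW.
pose U : polymx R n k 1 := \matrix_(i, j) ((c^-1 * v i 0) *: kernel_mpoly u y).
have UE x : mxeval U x = (c^-1 * u.[(hamming x y)%:R]) *: v.
  apply/matrixP => i j; rewrite !mxE mevalZ meval_kernel_mpoly (ord1 j); ring.
have SE x : mxeval (U *m U^T) x =
    ((2 ^ n)%:R / W * u.[(hamming x y)%:R] ^+ 2) *: (v *m v^T).
  rewrite mxeval_gram UE linearZ /= -scalemxAr -scalemxAl scalerA.
  congr (_ *: _); rewrite mulrACA -invfM -!expr2 c2 invf_div //.
have trv (A : 'M[R]_k) : \tr (A *m (v *m v^T)) = \sum_i v i 0 * (A *m v) i 0.
  rewrite mulmxA mxtrace_mulC /mxtrace big_ord1 mxE.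
  by apply: eq_bigr => i _; rewrite mxE.
rewrite -ler_pdivlMr //; have -> : (\sum_x
    (\sum_i v i 0 * (mxeval F x *m v) i 0) * u.[(hamming x y)%:R] ^+ 2) / W =
    cube_mean (fun x => \tr (mxeval F x *m mxeval (U *m U^T) x)).
  rewrite /cube_mean !mulr_suml; apply: eq_bigr => x _.
  rewrite SE -scalemxAr linearZ /= trv; field.
  by rewrite !gt_eqF.
apply: inner_bound_le.
  exists 1%N, 1%N, (fun=> U); split=> [_|]; last by rewrite big_ord1.
  apply/bigmax_leqP => i _; apply/bigmax_leqP => j _; rewrite mxE.
  rewrite -subn1 leq_subLR add1n; apply: leq_trans (mmeasureZ_le _ _ _) _.
  exact: mmeasure_kernel_mpoly.
rewrite /cube_mean; under eq_bigr => x _.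
  rewrite SE linearZ /= -[v *m v^T]mul1mx trv mul1mx.
  under eq_bigr do rewrite -expr2.
  rewrite v1 mulr1; over.
by rewrite -mulr_sumr -/W divfK ?divff // gt_eqF.
Qed.

Lemma Fmin_attained k (F : polymx R n k k) :
  exists y : cube n, Fmin F = lambda_min (mxeval F y).
Proof.
rewrite /Fmin; elim/big_ind: _ => [|a b [y ->] [z ->]|x _].
- by exists [ffun=> false].
- by case: leP => _; [exists y|exists z].
- by exists x.
Qed.

Lemma polynomial_averages_quadratic k (F : polymx R n k k) (v : 'cV[R]_k) y d :
  (mxdeg F <= d)%N ->
  polynomial_averages y d (fun x => \sum_i v i 0 * (mxeval F x *m v) i 0).
Proof.
move=> degF; apply: polynomial_averages_lin => i.
have -> : (fun x => (mxeval F x *m v) i 0) =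
    (fun x => \sum_j v j 0 * meval (cube_point R x) (F i j)).
  by apply: funext => x; rewrite mxE; apply: eq_bigr => j _; rewrite mxE mulrC.
apply: polynomial_averages_lin => j; apply: polynomial_averages_meval.
apply: leq_trans degF; rewrite /mxdeg (bigD1 i) //= leq_max; apply/orP; left.
by rewrite (bigD1 j) //= leq_maxl.
Qed.

End Kernel.

(** * The convergence rate of the inner bound *)

Theorem theorem7 (R : realType) (d : nat) :
  exists C : R, 0 < C /\
    forall (n k r : nat) (F : polymx R n k k),
      (d <= n)%N -> (1 <= n)%N -> (1 <= k)%N ->
      r.+1%:R / n%:R <= 1 / 2 :> R ->
      F^T = F ->
      mxdeg F = d ->
      (exists x : cube n, mxeval F x != 0) ->
      (inner_bound F r - Fmin F) / Fnorm F <= C * (xi R n r.+1 / n%:R).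
Proof.
(* Interpolation needs a positive degree bound, so d = 0 is treated as degree at most 1; n >= 1
   keeps the bound below [n]. *)
have [C C0 CP] := weighted_sum_bound R (leq_maxr d 1).
exists C; split=> // n k r F le_dn n0 k0 le_rn symF degF _.
have lt_rn : (r < n)%N.
  rewrite -(ltr_nat R); move: le_rn; rewrite ler_pdivrMr ?ltr0n // => le_rn.
  have : 0 < n%:R :> R by rewrite ltr0n.
  by move: le_rn; rewrite -natr1; lra.
have xin0 : 0 <= xi R n r.+1 / n%:R by rewrite divr_ge0 ?ler0n ?xi_ge0.
have Fnorm_ge x : spectral_norm (mxeval F x) <= Fnorm F by exact: le_bigmax.
have : 0 <= Fnorm F by exact: bigmax_ge_id.
rewrite le_eqVlt => /orP[/eqP<-|F0].
  (* For zero norm the quotient is 0 by the convention on inverses, and the right-hand side is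
     nonnegative. *)
  by rewrite invr0 mulr0 mulr_ge0 // ltW.
rewrite ler_pdivrMr // lerBlDl.
have [y FminE] := Fmin_attained F.
have symFy : (mxeval F y)^T = mxeval F y by rewrite /mxeval map_trmx symF.
have [v v1 Fv] := lambda_min_eigenvector k0 symFy.
pose f x := \sum_i v i 0 * (mxeval F x *m v) i 0.
have fy : f y = Fmin F.
  rewrite /f Fv FminE -[RHS]mulr1 -((norm2_eq1 v).1 v1) mulr_sumr.
  by apply: eq_bigr => i _; rewrite mxE; ring.
have [|||x|u [szu W0]] := CP n r y f (Fnorm F).
- by rewrite geq_max le_dn.
- by [].
- by apply: polynomial_averages_quadratic; rewrite degF leq_maxl.
- exact: le_trans (quadratic_le_spectral_norm _ v1) (Fnorm_ge x).
move/(le_trans (inner_bound_rank1_le F szu v1 W0)).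
by rewrite ler_pM2r // fy.
Qed.
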